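(* Let $(A,\lhd_1,\lhd_2,\rhd_1,\rhd_2)$ be a noncommutative pre-Novikov algebra and $(A,\prec,\succ)$ the associated noncommutative Novikov algebra, $\prec:=\lhd_1+\lhd_2$, $\succ:=\rhd_1+\rhd_2$. Then the identity map $\mathrm{id}$ on $A$ is an $\mathcal O$-operator of $(A,\prec,\succ)$ associated to the representation $(A,L_{\lhd_1},R_{\lhd_2},L_{\rhd_1},R_{\rhd_2})$.
   Context: $\mathbf k$ is a field of characteristic $0$; all vector spaces are finite-dimensional over $\mathbf k$. For a bilinear operation $\circ$ put $L_\circ(x)y=x\circ y=R_\circ(y)x$. A noncommutative Novikov algebra is a vector space $A$ with bilinear operations $\prec,\succ$ such that, with $\bullet:=\prec+\succ$, $(x\succ y)\prec z=x\succ(y\prec z)$ and $(x\prec y)\bullet z=x\bullet(y\succ z)$ for all $x,y,z\in A$. A representation of $(A,\prec,\succ)$ is $(V,\ell_\prec,r_\prec,\ell_\succ,r_\succ)$ with $V$ a vector space and linear maps $\ell_\prec,r_\prec,\ell_\succ,r_\succ:A\to\mathrm{End}(V)$ such that, with $\ell_\bullet=\ell_\prec+\ell_\succ$, $r_\bullet=r_\prec+r_\succ$, for all $x,y\in A$: $\ell_\prec(x\succ y)=\ell_\succ(x)\ell_\prec(y)$; $r_\prec(x)\ell_\succ(y)=\ell_\succ(y)r_\prec(x)$; $r_\prec(x)r_\succ(y)=r_\succ(y\prec x)$; $\ell_\bullet(x\prec y)=\ell_\bullet(x)\ell_\succ(y)$; $r_\bullet(x)\ell_\prec(y)=\ell_\bullet(y)r_\succ(x)$;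 $r_\bullet(x)r_\prec(y)=r_\bullet(y\succ x)$. A linear map $T:V\to A$ is an $\mathcal O$-operator of $(A,\prec,\succ)$ associated to $(V,\ell_\prec,r_\prec,\ell_\succ,r_\succ)$ if $T(u)*T(v)=T\big(\ell_*(T(u))v+r_*(T(v))u\big)$ for all $u,v\in V$ and $*\in\{\prec,\succ\}$. A noncommutative pre-Novikov algebra is a vector space with bilinear operations $\lhd_1,\lhd_2,\rhd_1,\rhd_2$ such that, with $\prec:=\lhd_1+\lhd_2$ and $\succ:=\rhd_1+\rhd_2$, for all $x,y,z$: $(x\succ y)\lhd_1z=x\rhd_1(y\lhd_1z)$; $(x\rhd_1y)\lhd_2z=x\rhd_1(y\lhd_2z)$; $(x\rhd_2y)\lhd_2z=x\rhd_2(y\prec z)$; $(x\prec y)\lhd_1z+(x\prec y)\rhd_1z=x\lhd_1(y\rhd_1z)+x\rhd_1(y\rhd_1z)$; $(x\lhd_1y)\lhd_2z+(x\lhd_1y)\rhd_2z=x\lhd_1(y\rhd_2z)+x\rhd_1(y\rhd_2z)$; $(x\lhd_2y)\lhd_2z+(x\lhd_2y)\rhd_2z=x\lhd_2(y\succ z)+x\rhd_2(y\succ z)$. In this case $(A,\prec,\succ)$ is a noncommutative Novikov algebra (the associated one) and $(A,L_{\lhd_1},R_{\lhd_2},L_{\rhd_1},R_{\rhd_2})$ is a representation of it. *)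

(* Defs.v *)
From HB Require Import structures.
From mathcomp Require Import all_boot all_order all_algebra.

Set Implicit Arguments.
Unset Strict Implicit.
Unset Printing Implicit Defensive.

Import GRing.Theory.
Local Open Scope ring_scope.

(* A bilinear operation on A is given in curried form, as a linear map from A *)
(* to End(A); sums of operations are sums in this Hom-space.                  *)
Notation binop A := 'Hom(A, 'End(A)).

Section Multiplications.
Variables (k : fieldType) (A : vectType k).
Implicit Type o : binop A.

Definition Lmul o : 'Hom(A, 'End(A)) := o.

(* linfun is only meaningful on linear functions; RmulE checks this. *)
Definition Rmul o : 'Hom(A, 'End(A)) := linfun (fun y => linfun (fun x => o x y)).

Lemma RmulE o x y : Rmul o y x = o x y.
Proof.
have lin1 v : linear (fun u => o u v).
  by move=> a u w; rewrite linearP !lfunE /= !lfunE.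
pose H1 v := GRing.isLinear.Build _ _ _ _ _ (lin1 v).
pose l1 v : {linear A -> A} := HB.pack (fun u => o u v) (H1 v).
have E1 u v : linfun (fun u => o u v) u = o u v by rewrite (lfunE (l1 v)).
have lin2 : linear (fun v => linfun (fun u => o u v)).
  move=> a v w; apply/lfunP => u; rewrite !add_lfunE !scale_lfunE !E1.
  by rewrite linearP.
pose H2 := GRing.isLinear.Build _ _ _ _ _ lin2.
pose l2 : {linear A -> 'End(A)} := HB.pack (fun v => linfun (fun u => o u v)) H2.
by rewrite /Rmul (lfunE l2) /= E1.
Qed.

End Multiplications.

Section Novikov.
Variables (k : fieldType) (A : vectType k).

Record nc_novikov (prec succ : binop A) : Prop := NcNovikov {
  nc_novikov_succ_prec : forall x y z,
    prec (succ x y) z = succ x (prec y z);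
  nc_novikov_prec_succ : forall x y z,
    (prec + succ) (prec x y) z = (prec + succ) x (succ y z)
}.

Record nc_novikov_rep (prec succ : binop A) (V : vectType k)
    (lp rp ls rs : 'Hom(A, 'End(V))) : Prop := NcNovikovRep {
  nc_novikov_rep1 : forall x y, lp (succ x y) = (ls x \o lp y)%VF;
  nc_novikov_rep2 : forall x y, (rp x \o ls y)%VF = (ls y \o rp x)%VF;
  nc_novikov_rep3 : forall x y, (rp x \o rs y)%VF = rs (prec y x);
  nc_novikov_rep4 : forall x y,
    (lp + ls) (prec x y) = ((lp + ls) x \o ls y)%VF;
  nc_novikov_rep5 : forall x y,
    ((rp + rs) x \o lp y)%VF = ((lp + ls) y \o rs x)%VF;
  nc_novikov_rep6 : forall x y,
    ((rp + rs) x \o rp y)%VF = (rp + rs) (succ y x)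
}.

(* O-operators are only defined for a representation of a noncommutative      *)
(* Novikov algebra, so these two requirements are part of the predicate.      *)
Record O_operator (prec succ : binop A) (V : vectType k)
    (lp rp ls rs : 'Hom(A, 'End(V))) (T : 'Hom(V, A)) : Prop := OOperator {
  O_operator_alg : nc_novikov prec succ;
  O_operator_rep : nc_novikov_rep prec succ lp rp ls rs;
  O_operator_prec : forall u v,
    prec (T u) (T v) = T (lp (T u) v + rp (T v) u);
  O_operator_succ : forall u v,
    succ (T u) (T v) = T (ls (T u) v + rs (T v) u)
}.

Record nc_pre_novikov (lhd1 lhd2 rhd1 rhd2 : binop A) : Prop := NcPreNovikov {
  nc_pre_novikov1 : forall x y z,
    lhd1 ((rhd1 + rhd2) x y) z = rhd1 x (lhd1 y z);
  nc_pre_novikov2 : forall x y z,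
    lhd2 (rhd1 x y) z = rhd1 x (lhd2 y z);
  nc_pre_novikov3 : forall x y z,
    lhd2 (rhd2 x y) z = rhd2 x ((lhd1 + lhd2) y z);
  nc_pre_novikov4 : forall x y z,
    lhd1 ((lhd1 + lhd2) x y) z + rhd1 ((lhd1 + lhd2) x y) z
      = lhd1 x (rhd1 y z) + rhd1 x (rhd1 y z);
  nc_pre_novikov5 : forall x y z,
    lhd2 (lhd1 x y) z + rhd2 (lhd1 x y) z
      = lhd1 x (rhd2 y z) + rhd1 x (rhd2 y z);
  nc_pre_novikov6 : forall x y z,
    lhd2 (lhd2 x y) z + rhd2 (lhd2 x y) z
      = lhd2 x ((rhd1 + rhd2) y z) + rhd2 x ((rhd1 + rhd2) y z)
}.

End Novikov.

(* Main.v *)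
Require Import Defs.
From HB Require Import structures.
From mathcomp Require Import all_boot all_order all_algebra.

Import GRing.Theory.
Local Open Scope ring_scope.

(** The O-operator identities for the identity map say that each product [o] of
    the associated algebra splits as
    [o u v = Lmul o1 u v + Rmul o2 v u], which is the definition [o = o1 + o2]
    of that product.  The content therefore lies in the two structural
    requirements.  The six pre-Novikov axioms are, evaluated at a vector and up
    to naming of the variables, exactly the six representation axioms for
    left multiplications by the operations of index 1 and right multiplications
    by the operations of index 2 ([nc_pre_novikov_rep]).  Adding axioms 1, 2, 3
    gives the first noncommutative Novikov identity, and adding axioms 4, 5, 6
    gives the second ([nc_pre_novikov_assoc]). *)

Lemma binopD {k : fieldType} {A : vectType k} (o1 o2 : binop A) x y :
  (o1 + o2) x y = o1 x y + o2 x y.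
Proof. by rewrite !add_lfunE. Qed.

Lemma binopDl {k : fieldType} {A : vectType k} (o : binop A) x y z :
  o (x + y) z = o x z + o y z.
Proof. by rewrite linearD add_lfunE. Qed.

(** Splitting the sums groups the terms by which of the three arguments plays
    the role of the module element: the third (axioms 1, 4), the second
    (axioms 2, 5) or the first (axioms 3, 6). *)
Lemma nc_pre_novikov_assoc {k : fieldType} {A : vectType k}
    {lhd1 lhd2 rhd1 rhd2 : binop A}
    (hA : nc_pre_novikov lhd1 lhd2 rhd1 rhd2) :
  nc_novikov (lhd1 + lhd2) (rhd1 + rhd2).
Proof.
case: hA => h1 h2 h3 h4 h5 h6; split=> x y z.
  rewrite binopD h1 (binopD rhd1 rhd2 x y) binopDl h2 h3.
  by rewrite (binopD rhd1) (binopD lhd1 lhd2 y z) !linearD /= !addrA.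
have L : (lhd1 + lhd2 + (rhd1 + rhd2)) ((lhd1 + lhd2) x y) z
    = (lhd1 ((lhd1 + lhd2) x y) z + rhd1 ((lhd1 + lhd2) x y) z)
      + (lhd2 (lhd1 x y) z + rhd2 (lhd1 x y) z)
      + (lhd2 (lhd2 x y) z + rhd2 (lhd2 x y) z).
  rewrite (addrACA lhd1) (binopD (lhd1 + rhd1)) (binopD lhd1 rhd1).
  rewrite (binopD lhd2 rhd2) -[RHS]addrA.
  by congr (_ + _); rewrite (binopD lhd1 lhd2) !binopDl addrACA.
rewrite L h4 h5 h6 (addrACA lhd1) (binopD (lhd1 + rhd1)) (binopD lhd1 rhd1).
rewrite (binopD lhd2 rhd2).
by congr (_ + _); rewrite (binopD rhd1 rhd2) !linearD /= addrACA.
Qed.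

Lemma nc_pre_novikov_rep {k : fieldType} {A : vectType k}
    {lhd1 lhd2 rhd1 rhd2 : binop A}
    (hA : nc_pre_novikov lhd1 lhd2 rhd1 rhd2) :
  nc_novikov_rep (lhd1 + lhd2) (rhd1 + rhd2)
    (Lmul lhd1) (Rmul lhd2) (Lmul rhd1) (Rmul rhd2).
Proof.
case: hA => h1 h2 h3 h4 h5 h6; rewrite /Lmul.
split=> x y; apply/lfunP=> z; rewrite ?comp_lfunE.
- exact: h1.
- by rewrite !RmulE h2.
- by rewrite !RmulE h3.
- by rewrite !(binopD lhd1 rhd1) h4.
- by rewrite (binopD (Rmul lhd2)) (binopD lhd1 rhd1) !RmulE h5.
- by rewrite !(binopD (Rmul lhd2)) !RmulE h6.
Qed.

Theorem proposition4p4 (k : fieldType) (char0 : [pchar k] =i pred0)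
    (A : vectType k) (lhd1 lhd2 rhd1 rhd2 : binop A)
    (hA : nc_pre_novikov lhd1 lhd2 rhd1 rhd2) :
  O_operator (lhd1 + lhd2) (rhd1 + rhd2)
    (Lmul lhd1) (Rmul lhd2) (Lmul rhd1) (Rmul rhd2)
    (\1%VF : 'Hom(A, A)).
Proof.
split=> [||u v|u v].
- exact: nc_pre_novikov_assoc hA.
- exact: nc_pre_novikov_rep hA.
- by rewrite !id_lfunE RmulE binopD.
- by rewrite !id_lfunE RmulE binopD.
Qed.
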